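(* Let $R(g)=\mathbb{K}[X(g)]$ be a trinomial algebra, graded by the fine grading with grading group $K$. For any $a,b\in\{0,1,2\}$ with $a\neq b$, and any $1\leqslant c_a\leqslant n_a$, $1\leqslant c_b\leqslant n_b$ such that $l_{bc_b}=1$, denote $$E(T_{ac_a},T_{bc_b})=\Bigl\{\deg g-\deg T_{ac_a}-\deg T_{bc_b}+\sum_{\substack{(i,j)\neq(a,c_a)\\(i,j)\neq(b,c_b)}}u_{ij}\deg T_{ij}\ \Bigm|\ u_{ij}\in\mathbb{Z}_{\geqslant0}\Bigr\}\subseteq K.$$ Then $e\in K$ is a root of $X(g)$ if and only if $e\in\bigcup E(T_{ac_a},T_{bc_b})$, where the union is over all $a,b\in\{0,1,2\}$ with $a\neq b$ and all integers $c_a,c_b$ with $1\leqslant c_a\leqslant n_a$, $1\leqslant c_b\leqslant n_b$ and $l_{bc_b}=1$.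
   Context: Let $\mathbb{K}$ be an algebraically closed field of characteristic zero. A derivation $\delta$ of a $\mathbb{K}$-algebra $R$ (a $\mathbb{K}$-linear map satisfying the Leibniz rule) is locally nilpotent if for every $f\in R$ there is $k\in\mathbb{Z}_{\geqslant0}$ with $\delta^k(f)=0$. Trinomial algebras. Fix $n_0,n_1,n_2\in\mathbb{Z}_{>0}$, put $n=n_0+n_1+n_2$, and for each $i=0,1,2$ fix a tuple $l_i=(l_{i1},\ldots,l_{in_i})\in\mathbb{Z}_{>0}^{n_i}$. In $\mathbb{K}[T_{ij}]=\mathbb{K}[T_{ij}\mid i=0,1,2,\ j=1,\ldots,n_i]$ put $T_i^{l_i}=T_{i1}^{l_{i1}}\cdots T_{in_i}^{l_{in_i}}$ and $g=T_0^{l_0}+T_1^{l_1}+T_2^{l_2}$ (a trinomial). The polynomial $g$ is irreducible; $X(g)=\{g=0\}\subseteq\mathbb{A}^n$ is the trinomial hypersurface and $R(g)=\mathbb{K}[T_{ij}]/(g)=\mathbb{K}[X(g)]$ is the trinomial algebra. The same notation is used for elements of $\mathbb{K}[T_{ij}]$ and their images in $R(g)$. Fine grading. Let $L=\begin{pmatrix}-l_0&l_1&0\\-l_0&0&l_2\end{pmatrix}$ ($2\times n$), $L^*$ its transpose, $K=\mathbb{Z}^n/\operatorname{Im}L^*$, $Q\colon\mathbb{Z}^n\to K$ the projection, $e_{ij}$ the standard basis vectors of $\mathbb{Z}^n$. Setting $\deg T_{ij}=Q(e_{ij})$ defines a $K$-grading on $\mathbb{K}[T_{ij}]$ for which $g$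 is homogeneous, of degree $\deg g=\sum_j l_{ij}\deg T_{ij}$ (the same element of $K$ for $i=0,1,2$), hence a $K$-grading on $R(g)$, the fine grading. A derivation $\delta$ of $R(g)$ is homogeneous if it maps homogeneous elements to homogeneous elements; then there is $w_0\in K$ with $\delta(R(g)_w)\subseteq R(g)_{w+w_0}$ for all $w\in K$, and $w_0$ is the degree of $\delta$. A root of $X(g)$ is an element of $K$ that is the degree of a nonzero homogeneous (for the fine grading) locally nilpotent derivation of $R(g)$. *)

(* Defs.v *)
(* Library: Mathematical Components, with multinomials for multivariate
   polynomials; from MathComp-Analysis only [boolp], used to turn membership in
   a subgroup and in an ideal into boolean predicates. *)
From HB Require Import structures.
From mathcomp Require Import all_boot all_order all_algebra.
From mathcomp Require Import mpoly.
From mathcomp Require Import boolp.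

Set Implicit Arguments.
Unset Strict Implicit.
Unset Printing Implicit Defensive.

Import GRing.Theory.
Local Open Scope ring_scope.
Local Open Scope quotient_scope.

(* The three blocks i = 0, 1, 2, and the entries j = 1, ..., n_i of each block
   (numbered from 0 here). *)
Record trinomial_data := TrinomialData {
  tri_size : 'I_3 -> nat;
  tri_exp : forall i : 'I_3, 'I_(tri_size i) -> nat;
  tri_size_gt0 : forall i, (0 < tri_size i)%N;
  tri_exp_gt0 : forall i (j : 'I_(tri_size i)), (0 < tri_exp j)%N
}.

Section FineGradingGroup.
Variable t : trinomial_data.

Definition tdim : nat := (\sum_(i < 3) tri_size t i)%N.

(* The position of the pair (i, j) among the n = n_0 + n_1 + n_2 coordinates;
   the inverse map is k |-> (tagnat.sig1 k, tagnat.sig2 k). *)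
Definition tidx (i : 'I_3) (j : 'I_(tri_size t i)) : 'I_tdim := tagnat.Rank i j.

Lemma tidx_inj i : injective (@tidx i).
Proof.
move=> j j' /(congr1 val)/eqP.
by rewrite /= tagnat.eq_Rank eqxx => /eqP/val_inj.
Qed.

(* The rows of L are (-l_0, l_1, 0) and (-l_0, 0, l_2): row r carries l_(r+1),
   and [lift ord0 r] is the block r + 1. *)
Definition tmatrix : 'M[int]_(2, tdim) :=
  \matrix_(r < 2, k < tdim)
    let l := (tri_exp (tagnat.sig2 k))%:Z in
    if tagnat.sig1 k == ord0 then - l
    else if tagnat.sig1 k == lift ord0 r then l else 0.

(* Z^n is the space of integer row vectors, so that Im L^* is the row space
   { w L | w in Z^2 }. *)
Definition imLT : {pred 'rV[int]_tdim} :=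
  fun v => `[< exists w : 'rV[int]_2, v = w *m tmatrix >].

Lemma imLT_zmod_closed : zmod_closed imLT.
Proof.
split=> [|u v]; rewrite !unfold_in.
  by apply/asboolP; exists 0; rewrite mul0mx.
move=> /asboolP[a ->] /asboolP[b ->]; apply/asboolP.
by exists (a - b); rewrite mulmxBl.
Qed.

HB.instance Definition _ :=
  GRing.isZmodClosed.Build 'rV[int]_tdim imLT imLT_zmod_closed.

(* Despite its name, [{ideal_quot _}] also denotes the quotient of an abelian
   group by a subgroup. *)
Definition fgroup := {ideal_quot imLT}.
HB.instance Definition _ := GRing.Zmodule.on fgroup.

Definition fproj (v : 'rV[int]_tdim) : fgroup := \pi_{ideal_quot imLT} v.

Definition degX (k : 'I_tdim) : fgroup := fproj (delta_mx 0 k).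

Definition degT (i : 'I_3) (j : 'I_(tri_size t i)) : fgroup := degX (tidx j).

Definition degM (m : 'X_{1..tdim}) : fgroup := \sum_(k < tdim) degX k *+ m k.

(* See [degg_block]: the block i = 0 may be replaced with any other one. *)
Definition degg : fgroup :=
  \sum_(j < tri_size t ord0) degT j *+ tri_exp j.

Lemma degMD m1 m2 : degM (m1 + m2)%MM = degM m1 + degM m2.
Proof.
by rewrite -big_split; apply: eq_bigr => k _; rewrite mnmDE mulrnDr.
Qed.

Lemma degM_var k : degM U_(k)%MM = degX k.
Proof.
rewrite /degM (bigD1 k) //= mnm1E eqxx big1 ?addr0 // => j nj.
by rewrite mnm1E eq_sym (negPf nj).
Qed.

Lemma fproj_is_zmod_morphism : zmod_morphism fproj.
Proof. by move=> u v; rewrite /fproj !piE. Qed.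

HB.instance Definition _ :=
  GRing.isZmodMorphism.Build 'rV[int]_tdim fgroup fproj fproj_is_zmod_morphism.

Lemma fproj_eq0 v : (fproj v == 0) = (v \in imLT).
Proof.
by rewrite -(raddf0 fproj) /fproj -Quotient.idealrBE subr0.
Qed.

Lemma degg_block (i : 'I_3) :
  degg = \sum_(j < tri_size t i) degT j *+ tri_exp j.
Proof.
pose S i : 'rV[int]_tdim :=
  \sum_(j < tri_size t i) delta_mx 0 (tidx j) *+ tri_exp j.
have SE i' : \sum_(j < tri_size t i') degT j *+ tri_exp j = fproj (S i').
  by rewrite raddf_sum; apply: eq_bigr => j _; rewrite raddfMn.
have Sk i' k : S i' 0 k =
    if tagnat.sig1 k == i' then (tri_exp (tagnat.sig2 k))%:Z else 0.
  rewrite /S summxE.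
  have [<-|ne] := eqVneq.
    rewrite (bigD1 (tagnat.sig2 k)) //= big1 => [|j nj].
      by rewrite addr0 mulmxnE mxE /tidx tagnat.sig2K !eqxx mulr1n natz.
    rewrite mulmxnE mxE -{1}[k]tagnat.sig2K (inj_eq (@tidx_inj _)) eq_sym.
    by rewrite (negPf nj) andbF mul0rn.
  rewrite big1 // => j _; rewrite mulmxnE mxE.
  have [e|_] := eqVneq k; last by rewrite andbF mul0rn.
  by rewrite e /tidx tagnat.Rank1K eqxx in ne.
rewrite /degg !SE; apply/eqP; rewrite -subr_eq0 -raddfB fproj_eq0.
case: (unliftP ord0 i) => [r ->|->]; last by rewrite subrr rpred0.
rewrite -rpredN opprB unfold_in; apply/asboolP.
exists (delta_mx 0 r); rewrite -rowE.
apply/rowP => k; rewrite !mxE !Sk.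
have [e0|_] := eqVneq (tagnat.sig1 k) ord0; last by rewrite subr0.
have [e1|_] := eqVneq (tagnat.sig1 k) (lift ord0 r); last by rewrite sub0r.
by case/eqP: (neq_lift ord0 r); rewrite -e1 e0.
Qed.

End FineGradingGroup.

Section TrinomialAlgebra.
Variables (k : closedFieldType) (t : trinomial_data).

Local Notation P := {mpoly k[tdim t]}.

Definition varT (i : 'I_3) (j : 'I_(tri_size t i)) : P := 'X_(tidx j).

Definition trinomial : P :=
  \sum_(i < 3) \prod_(j < tri_size t i) varT j ^+ tri_exp j.

Definition tideal : {pred P} := fun p => `[< exists q : P, p = q * trinomial >].

Lemma tideal_idealr_closed : idealr_closed tideal.
Proof.
split.
- by rewrite unfold_in; apply/asboolP; exists 0; rewrite mul0r.
- rewrite unfold_in; apply/asboolP => -[q /(congr1 (meval (fun=> 0)))].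
  rewrite rmorph1 rmorphM /= [X in _ * X](_ : _ = 0).
    by move/eqP; rewrite mulr0 oner_eq0.
  rewrite rmorph_sum big1 //= => i _; rewrite rmorph_prod.
  rewrite (bigD1 (Ordinal (tri_size_gt0 t i))) //= rmorphXn /= mevalXU.
  by rewrite expr0n eqn0Ngt tri_exp_gt0 mul0r.
- move=> a u v; rewrite !unfold_in => /asboolP[p ->] /asboolP[q ->].
  by apply/asboolP; exists (a * p + q); rewrite mulrDl mulrA.
Qed.

HB.instance Definition _ := isIdealr.Build P tideal tideal_idealr_closed.

Definition talg := {ideal_quot tideal}.
HB.instance Definition _ := GRing.ComNzRing.on talg.

Definition tproj (p : P) : talg := \pi_{ideal_quot tideal} p.

Lemma tproj_is_zmod_morphism : zmod_morphism tproj.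
Proof. by move=> u v; rewrite /tproj !piE. Qed.
Lemma tproj_is_monoid_morphism : monoid_morphism tproj.
Proof. by split=> [|u v]; rewrite /tproj !piE. Qed.

HB.instance Definition _ :=
  GRing.isZmodMorphism.Build P talg tproj tproj_is_zmod_morphism.
HB.instance Definition _ :=
  GRing.isMonoidMorphism.Build P talg tproj tproj_is_monoid_morphism.

Definition tscale (c : k) (f : talg) : talg := tproj c%:MP * f.

Lemma tscaleA a b f : tscale a (tscale b f) = tscale (a * b) f.
Proof. by rewrite /tscale mulrA -rmorphM -mpolyCM. Qed.
Lemma tscale1 : left_id 1 tscale.
Proof. by move=> f; rewrite /tscale mpolyC1 rmorph1 mul1r. Qed.
Lemma tscaleDr : right_distributive tscale +%R.
Proof. by move=> a f g; rewrite /tscale mulrDr. Qed.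
Lemma tscaleDl f : {morph tscale^~ f : a b / a + b}.
Proof. by move=> a b; rewrite /tscale mpolyCD rmorphD mulrDl. Qed.

HB.instance Definition _ := GRing.Zmodule_isLmodule.Build k talg
  tscaleA tscale1 tscaleDr tscaleDl.

Lemma tscaleAl (a : k) (f g : talg) : a *: (f * g) = (a *: f) * g.
Proof. exact: mulrA. Qed.

HB.instance Definition _ := GRing.Lmodule_isLalgebra.Build k talg tscaleAl.
HB.instance Definition _ := GRing.Lalgebra_isComAlgebra.Build k talg.

Lemma tprojZ (c : k) (p : P) : tproj (c *: p) = c *: tproj p.
Proof. by rewrite -mul_mpolyC rmorphM. Qed.

Definition mhomog (w : fgroup t) (p : P) : Prop :=
  forall m, m \in msupp p -> degM m = w.

Lemma mhomogX m : mhomog (degM m) 'X_[m].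
Proof. by move=> m'; rewrite msuppX inE => /eqP->. Qed.

Lemma mhomogM w1 w2 p1 p2 :
  mhomog w1 p1 -> mhomog w2 p2 -> mhomog (w1 + w2) (p1 * p2).
Proof.
move=> h1 h2 m /msuppM_le /allpairsP[[m1 m2] /= [/h1<- /h2<- ->]].
exact: degMD.
Qed.

Lemma mhomog1 : mhomog 0 1.
Proof.
by move=> m; rewrite msupp1 inE => /eqP->; apply: big1 => i _; rewrite mnm0E.
Qed.

Lemma mhomogXn w p n : mhomog w p -> mhomog (w *+ n) (p ^+ n).
Proof.
move=> h; elim: n => [|n IHn]; first exact: mhomog1.
by rewrite exprS mulrS; apply: mhomogM.
Qed.

Lemma mhomog_trinomial : mhomog (degg t) trinomial.
Proof.
apply: (big_ind (mhomog (degg t))) => [m|p q hp hq m /msuppD_le|i _].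
- by rewrite msupp0.
- by rewrite mem_cat => /orP[/hp|/hq].
rewrite (degg_block t i); apply: (big_ind2 mhomog) => [|w p v q|j _].
- exact: mhomog1.
- exact: mhomogM.
by apply: mhomogXn; rewrite /degT -degM_var; apply: mhomogX.
Qed.

(* The homogeneous component R(g)_w: the image of the polynomials that are
   homogeneous of degree w. *)
Definition thomog (w : fgroup t) (f : talg) : Prop :=
  exists2 p : P, mhomog w p & f = tproj p.

Definition is_thomog (f : talg) : Prop := exists w, thomog w f.

Definition homog_der (d : talg -> talg) : Prop :=
  forall f, is_thomog f -> is_thomog (d f).

Definition der_degree (d : talg -> talg) (w0 : fgroup t) : Prop :=
  forall w f, thomog w f -> thomog (w + w0) (d f).

End TrinomialAlgebra.

Definition leibniz (A : nzRingType) (d : A -> A) : Prop :=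
  forall f g, d (f * g) = d f * g + f * d g.

Definition locally_nilpotent (A : nzRingType) (d : A -> A) : Prop :=
  forall f, exists s : nat, iter s d f = 0.

Definition is_root (k : closedFieldType) (t : trinomial_data) (e : fgroup t) :
    Prop :=
  exists d : {linear talg k t -> talg k t},
    [/\ leibniz d, locally_nilpotent d, exists f, d f != 0,
        homog_der d & der_degree d e].

Definition Eset (t : trinomial_data) (a b : 'I_3)
    (ca : 'I_(tri_size t a)) (cb : 'I_(tri_size t b)) (e : fgroup t) : Prop :=
  exists u : 'I_(tdim t) -> nat,
    e = degg t - degT ca - degT cb
        + \sum_(p < tdim t | (p != tidx ca) && (p != tidx cb)) degX p *+ u p.

(* Main.v *)
(* Write F_i for the monomial T_i^l_i.

   Elements of E(T_a, T_b) are roots: for coordinates a and b with l_b = 1, the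
   derivation h (dg/db d/da - dg/da d/db), with h a monomial free of a and b,
   kills g, is triangular and has the required degree.

   Conversely, let d be a nonzero homogeneous LND of degree e.
   - R(g) has no homogeneous zero divisors: a homogeneous element is a monomial
     times a binary form in F_0 and F_1, and it can be tested at points where
     F_0 = x, F_1 = 1, F_2 = - 1 - x with all coordinates nonzero. Hence the
     order of nilpotency is additive on products of homogeneous elements.
   - If d T_p <> 0, then T_p does not divide d T_p, so there is a monomial of
     degree e + deg T_p that is free of T_p. Two monomials of the same degree
     differ by s_i l_i on the block i, with s_0 + s_1 + s_2 = 0, so each block
     contains at most one such p. As F_0 + F_1 + F_2 = 0, at least two blocks,
     say those of a and b, contain one.
   - If l_a, l_b > 1, the same comparison of exponents shows that T_b divides
     d T_a and T_a divides d T_b, which is impossible for the order. If, say,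
     l_b = 1, moving powers of F_b to the third block turns the monomial of
     degree e + deg T_a into one that exhibits e as an element of the set
     E(T_a, T_b). *)
From HB Require Import structures.
Require Import Defs.
From mathcomp Require Import all_boot all_order all_algebra.
From mathcomp Require Import mpoly.
From mathcomp Require Import boolp zify ring.

Set Implicit Arguments.
Unset Strict Implicit.
Unset Printing Implicit Defensive.

Import GRing.Theory.
Local Open Scope ring_scope.

(** * Exponents of monomials that have the same degree in $K$ *)

Section Monomials.
Variable t : trinomial_data.

Local Notation n := (tdim t).
Local Notation block := (@tagnat.sig1 3 (tri_size t)).

Definition expo (p : 'I_n) : nat := tri_exp (tagnat.sig2 p).

Lemma expo_gt0 p : (0 < expo p)%N.
Proof. exact: tri_exp_gt0. Qed.

Lemma block_tidx i (j : 'I_(tri_size t i)) : block (tidx j) = i.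
Proof. exact: tagnat.Rank1K. Qed.

Lemma expo_tidx i (j : 'I_(tri_size t i)) : expo (tidx j) = tri_exp j.
Proof.
rewrite /expo /tidx tagnat.Rank2K.
case: _ / (esym (tagnat.Rank1K j)); congr tri_exp; exact: val_inj.
Qed.

(** The exponent vector of the monomial F_i. *)
Definition blockM (i : 'I_3) : 'X_{1..n} :=
  [multinom if block p == i then expo p else 0%N | p < n].
Lemma blockME i p : blockM i p = if block p == i then expo p else 0%N.
Proof. exact: mnmE. Qed.

Lemma tidx_sig2 (p : 'I_n) : @tidx t (block p) (tagnat.sig2 p) = p.
Proof. exact: tagnat.sig2K. Qed.


Lemma blockM_sum i :
  blockM i = (\sum_(j < tri_size t i) U_(tidx j) *+ tri_exp j)%MM.
Proof.
apply/mnmP => p; rewrite blockME mnm_sumE.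
have [<-|ne] := eqVneq.
  rewrite (bigD1 (tagnat.sig2 p)) //= big1 => [|j nj].
    by rewrite addn0 mulmnE mnm1E tidx_sig2 eqxx mul1n.
  rewrite mulmnE mnm1E -[X in _ == X]tidx_sig2 (inj_eq (@tidx_inj _ _)).
  by rewrite (negPf nj).
rewrite big1 // => j _; rewrite mulmnE mnm1E.
have [e|_] := eqVneq; last exact: mul0n.
by rewrite -e block_tidx eqxx in ne.
Qed.

Lemma degM0 : @degM t 0%MM = 0.
Proof. by apply: big1 => p _; rewrite mnm0E. Qed.

Lemma degMn (m : 'X_{1..n}) r : degM (m *+ r)%MM = degM m *+ r.
Proof. by elim: r => [|r IH]; rewrite ?mulm0n ?degM0 // mulmS degMD IH mulrS. Qed.

Lemma degM_blockM i : degM (blockM i) = degg t.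
Proof.
rewrite blockM_sum (big_morph _ (@degMD t) degM0) (degg_block t i).
by apply: eq_bigr => j _; rewrite degMn degM_var.
Qed.

Lemma degM_proj (m : 'X_{1..n}) : degM m = fproj (\row_p (m p)%:Z).
Proof.
rewrite [X in fproj X]row_sum_delta raddf_sum; apply: eq_bigr => p _.
by rewrite mxE -natz scaler_nat raddfMn.
Qed.

Lemma tmatrixE r (p : 'I_n) : tmatrix t r p =
  if block p == ord0 then - (expo p)%:Z
  else if block p == lift ord0 r then (expo p)%:Z else 0.
Proof. by rewrite mxE. Qed.

(** The two exponent vectors differ by an element w L of Im L^*, and w L is a multiple of l_i on
    each block i. *)
Lemma degM_eq (m m' : 'X_{1..n}) : degM m = degM m' ->
  exists2 s : 'I_3 -> int, \sum_i s i = 0 &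
    forall p, (m p)%:Z = (m' p)%:Z + s (block p) * (expo p)%:Z.
Proof.
rewrite !degM_proj => /eqP; rewrite -subr_eq0 -raddfB fproj_eq0 unfold_in.
move=> /asboolP[w ew].
(* By the shape of L, block r + 1 gets w_r and block 0 gets minus the sum of the w_r. *)
exists (fun i => if unlift ord0 i is Some r then w 0 r else - (\sum_r w 0 r)).
  rewrite big_ord_recl unlift_none [X in _ + X](eq_bigr (w 0)) ?addNr // => r _.
  by rewrite liftK.
move=> p; apply/eqP; rewrite addrC -subr_eq; apply/eqP.
move/rowP/(_ p): ew; rewrite !mxE => ->.
case: unliftP => [r|] e0.
  rewrite (bigD1 r) //= big1 ?addr0 => [|r' ne]; rewrite tmatrixE e0.
    by rewrite eq_sym (negPf (neq_lift _ _)) eqxx.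
  rewrite eq_sym (negPf (neq_lift _ _)) (inj_eq lift_inj) eq_sym (negPf ne).
  by rewrite mulr0.
rewrite mulNr mulr_suml -sumrN; apply: eq_bigr => r _.
by rewrite tmatrixE e0 eqxx mulrN.
Qed.

(** Here m and m' stand for monomials of d T_a and d T_b; then m T_b and m' T_a have the same degree
    and can be compared. *)
Lemma degM_cross (m m' : 'X_{1..n}) (e : fgroup t) (a b : 'I_n) :
    degM m = e + degX a -> degM m' = e + degX b ->
  exists2 s : 'I_3 -> int, \sum_i s i = 0 &
    forall p, (m p + (b == p))%:Z = (m' p + (a == p))%:Z + s (block p) * (expo p)%:Z.
Proof.
move=> dm dm'; case: (@degM_eq (m + U_(b))%MM (m' + U_(a))%MM).
  by rewrite !degMD !degM_var dm dm' addrAC.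
by move=> s s0 hs; exists s => // p; rewrite -!mnm1E -!mnmDE.
Qed.

(** If a and b were distinct in one block, its coefficient s would satisfy m_b + 1 = s l_b and 0 =
    m'_a + 1 + s l_a, so it would be both positive and negative. *)
Lemma degM_block_uniq (m m' : 'X_{1..n}) (e : fgroup t) (a b : 'I_n) :
    degM m = e + degX a -> degM m' = e + degX b -> m a = 0%N -> m' b = 0%N ->
  block a = block b -> a = b.
Proof.
move=> dm dm' ma mb eab; have [//|ne] := eqVneq a b.
have [s _ hs] := degM_cross dm dm'.
have := hs a; have := hs b.
rewrite ma mb !eqxx eab (eq_sym b a) (negPf ne).
by move: (expo_gt0 a) (expo_gt0 b); nia.
Qed.

(** As T_a lies outside the block of b, the comparison at b reads m_b + 1 = s l_b. So the
    coefficient of this block is positive, and it is written [s.+1]. *)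
Lemma degM_block_shift (m m' : 'X_{1..n}) (e : fgroup t) (a b : 'I_n) :
    degM m = e + degX a -> degM m' = e + degX b -> m' b = 0%N ->
    block a != block b ->
  exists s : nat, (m b).+1 = (s.+1 * expo b)%N /\
    forall p, block p = block b -> (m p + (b == p) = m' p + s.+1 * expo p)%N.
Proof.
move=> dm dm' mb ne; have [s _ hs] := degM_cross dm dm'.
have neb p : block p = block b -> (a == p) = false.
  by move=> e'; apply: contraNF ne => /eqP->; rewrite e'.
have hb := hs b; rewrite eqxx neb // mb in hb.
have [r er] : exists r : nat, s (block b) = r.+1.
  exists (`|s (block b)|.-1)%N.
  by move: (expo_gt0 b); move: hb; nia.
exists r; split; first by move: hb; rewrite er; nia.
by move=> p ep; have := hs p; rewrite ep er neb //; nia.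
Qed.

Lemma third_block (i j : 'I_3) : exists c : 'I_3, (c != i) && (c != j).
Proof.
suff /existsP[c hc] : [exists c : 'I_3, (c != i) && (c != j)] by exists c.
apply: contraT; rewrite negb_exists => /forallP h.
move: (h ord0) (h (inord 1)) (h (inord 2)).
by rewrite -!val_eqE /= !inordK //; case: i j {h} => [i hi] [j hj] /=; lia.
Qed.

(** F_b^(s+1) divides m T_b. Replacing it by F_c^s, with c the third block, lowers the degree by
    exactly deg g and leaves a monomial free of T_a and T_b. *)
Lemma degM_Eset (m m' : 'X_{1..n}) (e : fgroup t) (a b : 'I_n) :
    degM m = e + degX a -> degM m' = e + degX b -> m a = 0%N -> m' b = 0%N ->
    block a != block b -> expo b = 1%N ->
  Eset (tagnat.sig2 a) (tagnat.sig2 b) e.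
Proof.
move=> dm dm' ma mb ne eb.
have [s [sb hs]] := degM_block_shift dm dm' mb ne.
have [c /andP[ca cb]] := third_block (block a) (block b).
(* The exponents of m T_b F_c^s / F_b^(s+1); by [hs] they agree with m' on the block of b, so they
   vanish at b. *)
pose u : 'X_{1..n} := [multinom if block p == block b then m' p
   else if block p == c then (m p + s * expo p)%N else m p | p < n].
have hu : (u + blockM (block b) *+ s.+1 = m + U_(b) + blockM c *+ s)%MM.
  apply/mnmP => p; rewrite !mnmDE !mulmnE !blockME mnm1E mnmE.
  have [ep|nep] := eqVneq (block p) (block b).
    by rewrite ep (eq_sym _ c) (negPf cb) hs // mulnC; lia.
  have -> : (b == p) = false by apply: contraNF nep => /eqP->.
  by case: (block p == c); lia.
have ua : u a = 0%N by rewrite mnmE (negPf ne) eq_sym (negPf ca).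
have ub : u b = 0%N by rewrite mnmE eqxx.
have ab : a != b by apply: contraNneq ne => ->.
exists (fun p => u p); rewrite /degT !tidx_sig2.
have := congr1 (@degM t) hu; rewrite !degMD !degMn !degM_blockM degM_var dm.
rewrite /degM (bigD1 a) //= (bigD1 b) ?(eq_sym b) //= ua ub !mulr0n !add0r.
set S := \sum_(p | _) _; rewrite mulrS addrA => /addIr eS.
by rewrite [RHS]addrC !addrA eS addrAC !addrK.
Qed.

End Monomials.

(** * Homogeneous elements of R(g) and the absence of homogeneous zero divisors *)

Section GradedDomain.
Variables (k : closedFieldType) (t : trinomial_data).

Local Notation n := (tdim t).
Local Notation block := (@tagnat.sig1 3 (tri_size t)).
Local Notation P := {mpoly k[n]}.
Local Notation A := (talg k t).
Local Notation tproj := (@tproj k t).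

Definition blockX (i : 'I_3) : P := 'X_[blockM t i].

Lemma trinomialE : trinomial k t = \sum_i blockX i.
Proof.
apply: eq_bigr => i _; rewrite /blockX blockM_sum -mprodXE.
by apply: eq_bigr => j _; rewrite -mpolyXn.
Qed.

Lemma tproj_eq0 (p : P) : tproj p = 0 -> exists q, p = q * trinomial k t.
Proof.
rewrite -(raddf0 tproj) => /eqP; rewrite /tproj -Quotient.idealrBE subr0.
by rewrite unfold_in => /asboolP.
Qed.

Lemma tproj_trinomial : tproj (trinomial k t) = 0.
Proof.
apply/eqP; rewrite -(raddf0 tproj) /tproj -Quotient.idealrBE subr0.
by rewrite unfold_in; apply/asboolP; exists 1; rewrite mul1r.
Qed.

Lemma tproj_surj (f : A) : exists p, f = tproj p.
Proof. by exists (repr f); rewrite /tproj reprK. Qed.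

Lemma tproj_sum p : tproj p = \sum_(m <- msupp p) p@_m *: tproj 'X_[m].
Proof.
by rewrite {1}(mpolyE p) raddf_sum; apply: eq_bigr => m _; exact: tprojZ.
Qed.

Lemma sum_blockX : \sum_i tproj (blockX i) = 0.
Proof. by rewrite -[RHS]tproj_trinomial trinomialE raddf_sum. Qed.

Lemma exists_nth_root r (c : k) : (0 < r)%N -> exists y, y ^+ r = c.
Proof.
move=> r0; have /closed_rootP[y] : size ('X^r - c%:P) != 1%N.
  by rewrite size_XnsubC // eqSS -lt0n.
by rewrite rootE !hornerE => /eqP/subr0_eq; exists y.
Qed.

(** In each block, the first coordinate is a root of y_i of order its exponent, and all other
    coordinates are 1. *)
Lemma exists_torus_point (y : 'I_3 -> k) : (forall i, y i != 0) ->
  exists2 v : 'I_n -> k, forall p, v p != 0 & forall i, (blockX i).@[v] = y i.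
Proof.
move=> y0.
have [r hr] : exists r : 'I_3 -> k, forall i,
    r i ^+ tri_exp (Ordinal (tri_size_gt0 t i)) = y i.
  apply: (@fin_all_exists _ _ (fun i r => r ^+ _ = y i)) => i.
  exact/exists_nth_root/tri_exp_gt0.
have r0 i : r i != 0.
  by apply: contraNneq (y0 i) => ri; rewrite -hr ri expr0n eqn0Ngt tri_exp_gt0.
pose first i : 'I_n := tidx (Ordinal (tri_size_gt0 t i)).
have bf i : block (first i) = i by exact: block_tidx.
exists (fun p => if p == first (block p) then r (block p) else 1) => [p|i].
  by case: ifP => _; rewrite ?r0 ?oner_eq0.
rewrite mevalX (bigD1 (first i)) //= [X in _ * X]big1 => [|p np].
  by rewrite blockME bf !eqxx expo_tidx hr mulr1.
rewrite blockME; case: (block p =P i) => [->|_]; last by rewrite expr0.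
by rewrite (negPf np) expr1n.
Qed.

(** A binary form of degree d in F_0 and F_1; only the values c_0, ..., c_d matter. *)
Definition form d (c : nat -> k) : P :=
  \sum_(s < d.+1) c s *: (blockX ord0 ^+ s * blockX (lift ord0 ord0) ^+ (d - s)).

Definition is_form d (f : A) : Prop := exists c, f = tproj (form d c).

Lemma form0 d : form d (fun=> 0) = 0.
Proof. by apply: big1 => s _; rewrite scale0r. Qed.

Lemma is_formD d f g : is_form d f -> is_form d g -> is_form d (f + g).
Proof.
move=> [c ->] [c' ->]; exists (fun s => c s + c' s).
rewrite -raddfD /form -big_split; congr Defs.tproj; apply: eq_bigr => s _.
by rewrite scalerDl.
Qed.

Lemma is_formZ d a f : is_form d f -> is_form d (a *: f).
Proof.
move=> [c ->]; exists (fun s => a * c s).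
rewrite -tprojZ /form scaler_sumr; congr Defs.tproj; apply: eq_bigr => s _.
by rewrite scalerA.
Qed.

(** Multiplication by F_0 shifts the coefficients, multiplication by F_1 keeps them, and F_2 equals
    - F_0 - F_1 in R(g). *)
Lemma is_form_mul d f i : is_form d f -> is_form d.+1 (tproj (blockX i) * f).
Proof.
move=> ff.
have h0 : is_form d.+1 (tproj (blockX ord0) * f).
  case: ff => c ->; exists (fun s => if s is r.+1 then c r else 0).
  rewrite -rmorphM /form [in RHS]big_ord_recl scale0r add0r mulr_sumr.
  congr Defs.tproj; apply: eq_bigr => s _.
  by rewrite -scalerAr mulrA -exprS lift0 subSS.
have h1 : is_form d.+1 (tproj (blockX (lift ord0 ord0)) * f).
  case: ff => c ->; exists (fun s => if (s <= d)%N then c s else 0).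
  rewrite -rmorphM /form [in RHS]big_ord_recr /= ltnn scale0r addr0 mulr_sumr.
  congr Defs.tproj; apply: eq_bigr => s _.
  by rewrite -ltnS ltn_ord -scalerAr mulrCA -exprS subSn // -ltnS.
case: (unliftP ord0 i) => [j ->|-> //]; case: (unliftP ord0 j) => [l ->|-> //].
have -> : tproj (blockX (lift ord0 (lift ord0 l))) =
    -1 *: (tproj (blockX ord0) + tproj (blockX (lift ord0 ord0))).
  rewrite scaleN1r; apply/eqP; rewrite -addr_eq0 addrC -sum_blockX.
  by rewrite !big_ord_recl big_ord0 addr0 addrA (ord1 l).
by rewrite -scalerAl mulrDl; apply/is_formZ/is_formD.
Qed.

Lemma is_form_prod (u : 'I_3 -> nat) :
  is_form (\sum_i u i) (tproj 'X_[\sum_i blockM t i *+ u i]).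
Proof.
have -> : tproj 'X_[\sum_i blockM t i *+ u i] = \prod_i tproj (blockX i) ^+ u i.
  rewrite -mprodXE rmorph_prod; apply: eq_bigr => i _.
  by rewrite -mpolyXn rmorphXn.
apply: (big_rec2 (fun d f => is_form d f)) => [|i d f _ ff].
  by exists (fun=> 1); rewrite /form big_ord1 !expr0 mulr1 scale1r rmorph1.
elim: (u i) => [|r IH]; first by rewrite mul1r.
by rewrite exprS -mulrA; apply: is_form_mul.
Qed.

Lemma blockM_gt0 i : (0 < mdeg (blockM t i))%N.
Proof.
pose p : 'I_n := tidx (Ordinal (tri_size_gt0 t i)).
rewrite lt0n mdeg_eq0; apply/eqP => /mnmP/(_ p)/eqP.
by rewrite blockME block_tidx eqxx mnm0E eqn0Ngt expo_gt0.
Qed.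

Lemma sum_blockME (u : 'I_3 -> nat) (p : 'I_n) :
  (\sum_i blockM t i *+ u i)%MM p = (u (block p) * expo p)%N.
Proof.
rewrite mnm_sumE (bigD1 (block p)) //= big1 => [|i ni].
  by rewrite addn0 mulmnE blockME eqxx mulnC.
by rewrite mulmnE blockME eq_sym (negPf ni).
Qed.

(** Dividing by some F_i as long as possible terminates, since each division lowers the total
    degree. *)
Lemma block_reduction (m : 'X_{1..n}) : exists (v : 'X_{1..n}) (u : 'I_3 -> nat),
  m = (v + \sum_i blockM t i *+ u i)%MM /\ forall i, ~~ (blockM t i <= v)%MM.
Proof.
have [r] := ubnP (mdeg m); elim: r m => // r IH m lt_m.
have [/existsP[i le_im]|/existsPn h] := boolP [exists i, (blockM t i <= m)%MM].
  have [|v [u [em hv]]] := IH (m - blockM t i)%MM.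
    move: lt_m (blockM_gt0 i); rewrite -{1}(submK le_im) mdegD; lia.
  exists v, (fun j => u j + (i == j))%N; split=> //.
  rewrite -(submK le_im) em; apply/mnmP => p.
  rewrite !mnmDE !sum_blockME blockME mulnDl addnA (eq_sym i).
  by case: (block p == i); rewrite ?mul1n ?mul0n.
exists m, (fun=> 0%N); split=> //; apply/mnmP => p.
by rewrite mnmDE sum_blockME addn0.
Qed.

(** The reduced part v depends on the degree only: m is v times the product of the F_i^(u_i + s_i),
    where the s_i have sum zero. *)
Lemma block_reductionP (v m : 'X_{1..n}) (u : 'I_3 -> nat) :
    (forall i, ~~ (blockM t i <= v)%MM) ->
    degM m = degM (v + \sum_i blockM t i *+ u i)%MM ->
  exists2 u' : 'I_3 -> nat, m = (v + \sum_i blockM t i *+ u' i)%MM &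
    (\sum_i u' i = \sum_i u i)%N.
Proof.
move=> hv /degM_eq[s s0 hs].
have us i : 0 <= (u i)%:Z + s i.
  (* Some p in block i has v_p < l_p, so a negative u_i + s_i would make m_p negative. *)
  have /forallPn[p] := hv i.
  have := hs p; rewrite blockME mnmDE sum_blockME.
  case: (block p =P i) => [->|_ _]; last by rewrite leq0n.
  by move: (expo_gt0 p); nia.
exists (fun i => absz ((u i)%:Z + s i)).
  apply/mnmP => p; rewrite mnmDE sum_blockME.
  have := hs p; rewrite mnmDE sum_blockME; have := us (block p); nia.
move: s0 (us ord0) (us (lift ord0 ord0)) (us (lift ord0 (lift ord0 ord0))).
rewrite !big_ord_recl !big_ord0; lia.
Qed.

(* A degree-w monomial is v times a monomial in the three block monomials, with
   v depending only on w; and F_2 = - F_0 - F_1 in the quotient. *)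
Lemma homog_normal_form w p : mhomog w p ->
  exists v d c, tproj p = tproj ('X_[v] * form d c).
Proof.
move=> hp; case ep: (msupp p) => [|m0 ms].
  by exists 0%MM, 0%N, (fun=> 0); rewrite form0 mulr0 (msuppnil0 ep).
have [v [u [em0 hv]]] := block_reduction m0.
exists v, (\sum_i u i)%N.
suff [f [c ->] ->] : exists2 f, is_form (\sum_i u i) f & tproj p = tproj 'X_[v] * f.
  by exists c; rewrite -rmorphM.
rewrite tproj_sum [\sum_(m <- msupp p) _]big_seq.
apply: (big_ind (fun x => exists2 f, is_form _ f & x = tproj 'X_[v] * f)).
- by exists 0; [exists (fun=> 0); rewrite form0 raddf0 | rewrite mulr0].
- move=> _ _ [f ff ->] [f' ff' ->].
  by exists (f + f'); [exact: is_formD | rewrite mulrDr].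
move=> m hm; have [|u' em <-] := @block_reductionP v m u hv.
  by rewrite -em0 (hp _ hm) (hp m0) // ep mem_head.
exists (p@_m *: tproj 'X_[\sum_i blockM t i *+ u' i]).
  exact/is_formZ/is_form_prod.
by rewrite {2}em mpolyXD rmorphM scalerAr.
Qed.

(** Evaluation at a point of X(g) depends only on the class in R(g). *)
Lemma meval_tproj (v : 'I_n -> k) p p' :
  \sum_i (blockX i).@[v] = 0 -> tproj p = tproj p' -> p.@[v] = p'.@[v].
Proof.
move=> v0 /eqP; rewrite -subr_eq0 -raddfB => /eqP/tproj_eq0[q eq].
apply/eqP; rewrite -subr_eq0 -mevalB eq mevalM trinomialE raddf_sum.
by rewrite [X in _ * X]v0 mulr0.
Qed.

(** Setting F_1 = 1 dehomogenizes the binary form. *)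
Lemma meval_form (v : 'I_n -> k) x d c :
    (blockX ord0).@[v] = x -> (blockX (lift ord0 ord0)).@[v] = 1 ->
  (form d c).@[v] = (\poly_(s < d.+1) c s).[x].
Proof.
move=> v0 v1; rewrite horner_poly raddf_sum; apply: eq_bigr => s _.
by rewrite [LHS]mevalZ mevalM !rmorphXn /= v0 v1 expr1n mulr1.
Qed.

Lemma exists_trinomial_point (x : k) : x != 0 -> x != -1 ->
  exists v : 'I_n -> k, [/\ forall p, v p != 0, \sum_i (blockX i).@[v] = 0,
    (blockX ord0).@[v] = x & (blockX (lift ord0 ord0)).@[v] = 1].
Proof.
move=> x0 x1.
pose y (i : 'I_3) :=
  if i == ord0 then x else if i == lift ord0 ord0 then 1 else - (x + 1).
have [|v v0 hv] := @exists_torus_point y.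
  move=> i; rewrite /y; case: ifP => // _; case: ifP => _; first exact: oner_neq0.
  by rewrite oppr_eq0 addr_eq0.
exists v; split; rewrite ?hv //; under eq_bigr do rewrite hv.
by rewrite !big_ord_recl big_ord0 addr0 /y /= addrA subrr.
Qed.

Lemma meval_monomial_neq0 (v : 'I_n -> k) m :
  (forall p, v p != 0) -> ('X_[m] : P).@[v] != 0.
Proof.
by move=> v0; rewrite mevalX prodf_seq_neq0; apply/allP => p _; rewrite expf_neq0.
Qed.

Lemma exists_generic (h : {poly k}) : h != 0 ->
  exists x, [/\ x != 0, x != -1 & h.[x] != 0].
Proof.
(* The two extra factors exclude the values 0 and -1. *)
move=> h0; have /closed_nonrootP[x] : h * 'X * ('X + 1%:P) != 0.
  by rewrite !mulf_neq0 ?polyX_eq0 // -size_poly_eq0 size_XaddC.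
rewrite /root !hornerE !mulf_eq0 !negb_or addr_eq0 => /andP[/andP[hx x0] x1].
by exists x.
Qed.

Lemma tprojX_neq0 m : tproj 'X_[m] != 0.
Proof.
have [x [x0 x1 _]] := exists_generic (oner_neq0 _).
have [v [v0 hv _ _]] := exists_trinomial_point x0 x1.
apply/eqP; rewrite -[RHS](raddf0 tproj) => /(meval_tproj hv)/eqP.
by rewrite meval0 (negPf (meval_monomial_neq0 _ v0)).
Qed.

(** If both dehomogenized forms are nonzero, there is a point of X(g) with nonzero coordinates at
    which neither of them vanishes, and so neither does the product. *)
Lemma thomog_mul_eq0 w w' (f f' : A) :
  thomog w f -> thomog w' f' -> f * f' = 0 -> f = 0 \/ f' = 0.
Proof.
move=> [p /homog_normal_form[u [d [c ep]]] ->].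
move=> [p' /homog_normal_form[u' [d' [c' ep']]] ->].
rewrite {}ep {}ep' -rmorphM -{1}(raddf0 tproj) => e0.
have form_eq0 r b : \poly_(s < r.+1) b s = 0 :> {poly k} -> form r b = 0.
  move=> /polyP e; apply: big1 => s _; have := e s.
  by rewrite coef_poly ltn_ord coef0 => ->; rewrite scale0r.
have [/form_eq0-> | h0] := eqVneq (\poly_(s < d.+1) c s) 0.
  by left; rewrite mulr0 raddf0.
have [/form_eq0-> | h0'] := eqVneq (\poly_(s < d'.+1) c' s) 0.
  by right; rewrite mulr0 raddf0.
have [x [x0 x1 hx]] := exists_generic (mulf_neq0 h0 h0').
have [v [v0 hv va vb]] := exists_trinomial_point x0 x1.
move/(meval_tproj hv)/eqP: e0; rewrite !mevalM !(meval_form _ _ va vb) meval0.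
move: hx; rewrite hornerM !mulf_eq0 !(negPf (meval_monomial_neq0 _ v0)) /=.
by move/negPf->.
Qed.

End GradedDomain.

(** * Iterates of a derivation and orders of nilpotency *)

Section LocallyNilpotent.
Variables (A : comNzRingType) (d : {additive A -> A}).
Hypothesis d_leibniz : leibniz d.

Lemma iter_der0 s : iter s d 0 = 0.
Proof. by elim: s => // s IH; rewrite iterS IH raddf0. Qed.

Lemma iter_derD s f g : iter s d (f + g) = iter s d f + iter s d g.
Proof. by elim: s => // s IH; rewrite !iterS IH raddfD. Qed.

Lemma iter_der_ge s r f : (s <= r)%N -> iter s d f = 0 -> iter r d f = 0.
Proof. by move=> le_sr e0; rewrite -(subnK le_sr) iterD e0 iter_der0. Qed.

Lemma der1 : d 1 = 0.
Proof.
apply: (addrI (d 1)); rewrite addr0; have := d_leibniz 1 1.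
by rewrite !mulr1 mul1r => /esym.
Qed.

Lemma derX f r : d (f ^+ r.+1) = f ^+ r * d f *+ r.+1.
Proof.
elim: r => [|r IH]; first by rewrite mul1r.
by rewrite exprS d_leibniz IH -mulrnAr mulrA -exprS mulrC mulrnAr -mulrS.
Qed.

(** In the Leibniz formula for the iterate of order b + c only one term survives. The induction on b
    + c combines its two halves by Pascal's rule. *)
Lemma iter_leibniz_top b c f h :
    iter b.+1 d f = 0 -> iter c.+1 d h = 0 ->
  iter (b + c) d (f * h) = iter b d f * iter c d h *+ 'C(b + c, b).
Proof.
move er: (b + c)%N => r; elim: r => [|r IH] in b c f h er *.
  by case: b c er => [|b] [|c].
move=> f0 h0; rewrite iterSr d_leibniz iter_derD.
case: b c er f0 h0 => [|b] [|c] // er f0 h0.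
(* If b or c is 0, then d f or d h is 0 and only one half remains. *)
- rewrite [d f]f0 mul0r iter_der0 add0r (IH 0%N c) ?bin0 -?iterSr //.
  by case: er.
- have er' : (b + 0)%N = r by lia.
  rewrite [d h]h0 mulr0 iter_der0 addr0 (IH b 0%N) -?iterSr //.
  by rewrite -er' addn0 binn -(addn0 b.+1) addn0 binn.
rewrite (IH b c.+1) -?iterSr // ?(IH b.+1 c) -?iterSr //; try lia.
by rewrite -mulrnDr addnC -binS.
Qed.

Definition nilpotent_at f := exists s, iter s d f = 0.

Lemma nilpotent_at0 : nilpotent_at 0.
Proof. by exists 0%N. Qed.

Lemma nilpotent_at1 : nilpotent_at 1.
Proof. by exists 1%N; rewrite /= der1. Qed.

Lemma nilpotent_atD f g :
  nilpotent_at f -> nilpotent_at g -> nilpotent_at (f + g).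
Proof.
move=> [s fs] [r gr]; exists (s + r)%N; rewrite iter_derD.
by rewrite (iter_der_ge _ fs) ?leq_addr // (iter_der_ge _ gr) ?leq_addl // addr0.
Qed.

Lemma nilpotent_atM f g :
  nilpotent_at f -> nilpotent_at g -> nilpotent_at (f * g).
Proof.
move=> [s fs] [r gr]; exists (s + r).+1.
have fs' := iter_der_ge (leqnSn s) fs; have gr' := iter_der_ge (leqnSn r) gr.
by rewrite iterS iter_leibniz_top // fs mul0r mul0rn raddf0.
Qed.

Lemma nilpotent_atX f r : nilpotent_at f -> nilpotent_at (f ^+ r).
Proof.
move=> ff; elim: r => [|r IH]; first exact: nilpotent_at1.
by rewrite exprS; apply: nilpotent_atM.
Qed.

Lemma nilpotent_at_der f : nilpotent_at (d f) -> nilpotent_at f.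
Proof. by move=> [s fs]; exists s.+1; rewrite iterSr. Qed.

Lemma exists_order f : f != 0 -> nilpotent_at f ->
  exists2 b, iter b d f != 0 & iter b.+1 d f = 0.
Proof.
move=> f0 [s fs]; have exs : exists s, iter s d f == 0 by exists s; apply/eqP.
case: (ex_minnP exs) => -[|b] /eqP eb minb; first by rewrite [f]eb eqxx in f0.
by exists b => //; apply/negP => /minb; rewrite ltnn.
Qed.

End LocallyNilpotent.

(** * The degree of a nonzero homogeneous LND lies in some set E(T_a, T_b) *)

Section HomogeneousLND.
Variables (k : closedFieldType) (t : trinomial_data).
Hypothesis k_char0 : [pchar k] =i pred0.

Local Notation n := (tdim t).
Local Notation block := (@tagnat.sig1 3 (tri_size t)).
Local Notation P := {mpoly k[n]}.
Local Notation A := (talg k t).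
Local Notation tproj := (@tproj k t).

Variables (d : {linear A -> A}) (e : fgroup t).
Hypothesis d_leibniz : leibniz d.
Hypothesis d_lnd : locally_nilpotent d.
Hypothesis d_deg : der_degree d e.

Lemma talg_mulrn_eq0 (f : A) r : f *+ r.+1 = 0 -> f = 0.
Proof.
rewrite -scaler_nat => /eqP; rewrite scaler_eq0 => /orP[|/eqP//].
by move/pcharf0P: k_char0 => ->.
Qed.

Lemma thomog_iter w f s : thomog w f -> thomog (w + e *+ s) (iter s d f).
Proof.
move=> wf; elim: s => [|s IH]; first by rewrite addr0.
by rewrite mulrSr addrA; apply: d_deg.
Qed.

(** The iterate of order b + c of f h is a positive binomial multiple of a product of two nonzero
    homogeneous elements, which is nonzero in characteristic zero. *)
Lemma order_mul w w' f h : thomog w f -> thomog w' h -> f != 0 -> h != 0 ->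
  exists b c, [/\ iter b d f != 0, iter b.+1 d f = 0 & iter (b + c) d (f * h) != 0].
Proof.
move=> wf wh f0 h0.
have [b bf bf0] := exists_order f0 (d_lnd f).
have [c ch ch0] := exists_order h0 (d_lnd h).
exists b, c; split=> //; rewrite (iter_leibniz_top d_leibniz) //.
have : (0 < 'C(b + c, b))%N by rewrite bin_gt0 leq_addr.
case: 'C(_, _) => // r _; apply/eqP => /talg_mulrn_eq0.
by case/(thomog_mul_eq0 (thomog_iter b wf) (thomog_iter c wh)) => /eqP; apply/negP.
Qed.

(* Write ord f for the last b with [iter b d f != 0]. Then
   ord f1 = ord f2 + ord h1 + 1 and ord f2 = ord f1 + ord h2 + 1. *)
Lemma der_cross_eq0 w1 w2 v1 v2 f1 f2 h1 h2 :
    thomog w1 f1 -> thomog w2 f2 -> thomog v1 h1 -> thomog v2 h2 ->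
    d f1 = f2 * h1 -> d f2 = f1 * h2 ->
  d f1 = 0 \/ d f2 = 0.
Proof.
move=> wf1 wf2 wh1 wh2 e1 e2.
have [|n1] := eqVneq (d f1) 0; first by left.
have [|n2] := eqVneq (d f2) 0; first by right.
have f10 : f1 != 0 by apply: contraNneq n1 => ->; rewrite raddf0.
have f20 : f2 != 0 by apply: contraNneq n2 => ->; rewrite raddf0.
have h10 : h1 != 0 by apply: contraNneq n1 => h10; rewrite e1 h10 mulr0.
have h20 : h2 != 0 by apply: contraNneq n2 => h20; rewrite e2 h20 mulr0.
have [b2 [c1 [b2f b2f0]]] := order_mul wf2 wh1 f20 h10.
have [b1 [c2 [b1f b1f0]]] := order_mul wf1 wh2 f10 h20.
rewrite -e1 -e2 -!iterSr => nz2 nz1.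
have lt1 : ((b2 + c1).+1 < b1.+1)%N.
  by rewrite ltnNge; apply: contra nz1 => le1; rewrite (iter_der_ge le1).
have lt2 : ((b1 + c2).+1 < b2.+1)%N.
  by rewrite ltnNge; apply: contra nz2 => le2; rewrite (iter_der_ge le2).
by lia.
Qed.

Lemma mhomogD w (p q : P) : mhomog w p -> mhomog w q -> mhomog w (p + q).
Proof. by move=> hp hq m /msuppD_le; rewrite mem_cat => /orP[/hp|/hq]. Qed.

Lemma mhomogZ w c (p : P) : mhomog w p -> mhomog w (c *: p).
Proof. by move=> hp m /msuppZ_le/hp. Qed.

Lemma thomog_var p : thomog (degX p) (tproj 'X_p).
Proof. by exists 'X_p => //; rewrite -degM_var; apply: mhomogX. Qed.

Lemma thomog_monomial m : thomog (degM m) (tproj 'X_[m]).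
Proof. by exists 'X_[m] => //; apply: mhomogX. Qed.

Lemma thomogM w w' (f h : A) :
  thomog w f -> thomog w' h -> thomog (w + w') (f * h).
Proof.
move=> [p hp ->] [q hq ->]; exists (p * q); first exact: mhomogM.
by rewrite rmorphM.
Qed.

Lemma mhomog_div_var w (q : P) p : mhomog w q ->
    (forall m, m \in msupp q -> (0 < m p)%N) ->
  exists2 q', mhomog (w - degX p) q' & q = 'X_p * q'.
Proof.
move=> hq hp; exists (\sum_(m <- msupp q) q@_m *: 'X_[m - U_(p)]).
  rewrite big_seq; apply: (big_ind (mhomog (w - degX p))) => [m||m qm].
  - by rewrite msupp0.
  - exact: mhomogD.
  apply: mhomogZ; rewrite -(hq _ qm) -{1}[m](@submK _ U_(p)).
    by rewrite degMD degM_var addrK; apply: mhomogX.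
  by rewrite lep1mP -lt0n hp.
rewrite [LHS]mpolyE mulr_sumr !big_seq; apply: eq_bigr => m qm.
rewrite -scalerAr -mpolyXD addmC submK //.
by rewrite lep1mP -lt0n hp.
Qed.

(** All monomials of a representative of d T_p have degree e + deg T_p. The cofactor is kept
    homogeneous so that [der_cross_eq0] applies. *)
Lemma der_var_divisible p r :
    (forall m, degM m = e + degX p -> (0 < m r)%N) ->
  exists w h, thomog w h /\ d (tproj 'X_p) = tproj 'X_r * h.
Proof.
move=> hr; have [q hq eq] := d_deg (thomog_var p).
have [|q' hq' eq'] := @mhomog_div_var _ q r hq.
  by move=> m /hq em; apply: hr; rewrite em addrC.
exists (degX p + e - degX r), (tproj q'); split; first by exists q'.
by rewrite eq eq' rmorphM.
Qed.

Lemma der_var_monomial p : d (tproj 'X_p) != 0 ->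
  exists2 m, degM m = e + degX p & m p = 0%N.
Proof.
move=> np; apply: contrapT => no_m.
have [|w [h [wh eh]]] := @der_var_divisible p p.
  move=> m em; rewrite lt0n; apply/eqP => mp; apply: no_m.
  by exists m.
have vp := thomog_var p.
(* The case f1 = f2 = T_p: if T_p divides d T_p, then d T_p = 0. *)
by case: (der_cross_eq0 vp vp wh wh eh eh) => d0; rewrite d0 eqxx in np.
Qed.

Lemma der_monomial_eq0 (m : 'X_{1..n}) :
  (forall p, m p != 0%N -> d (tproj 'X_p) = 0) -> d (tproj 'X_[m]) = 0.
Proof.
move=> hm; rewrite mpolyXE_id rmorph_prod.
apply: (big_ind (fun f => d f = 0)) => [|f g f0 g0|p _].
- exact: der1.
- by rewrite d_leibniz f0 g0 mul0r mulr0 addr0.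
rewrite rmorphXn /=; case em: (m p) => [|r]; first exact: der1.
by rewrite derX //= hm ?em // mulr0 mul0rn.
Qed.

Lemma der_eq0 : (forall p, d (tproj 'X_p) = 0) -> forall f, d f = 0.
Proof.
move=> hd f; have [q ->] := tproj_surj f.
rewrite tproj_sum linear_sum big1 // => m _.
by rewrite linearZ /= der_monomial_eq0 ?scaler0.
Qed.

Lemma der_var_block_uniq p r :
  d (tproj 'X_p) != 0 -> d (tproj 'X_r) != 0 -> block p = block r -> p = r.
Proof.
move=> /der_var_monomial[m em mp] /der_var_monomial[m' em' mr].
exact: degM_block_uniq em em' mp mr.
Qed.

(** Otherwise T_p is the only variable that d does not kill, so d kills the F_i of the two other
    blocks and, as the sum is zero, also the F of the block of p. But d of the latter is a nonzero
    monomial multiple of d T_p. *)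
Lemma der_var_two_blocks p : d (tproj 'X_p) != 0 ->
  exists2 r, d (tproj 'X_r) != 0 & block p != block r.
Proof.
move=> np; apply: contrapT => no_r.
have other r : r != p -> d (tproj 'X_r) = 0.
  move=> ne; apply/eqP/negP => /negP nr; apply: no_r; exists r => //.
  by apply: contraNneq ne => eb; rewrite (der_var_block_uniq np nr eb).
have dB i : i != block p -> d (tproj (blockX k t i)) = 0.
  move=> ni; apply: der_monomial_eq0 => r; rewrite blockME.
  case: (block r =P i) => // er _; apply: other.
  by apply: contraNneq ni => <-; rewrite er.
have dp : d (tproj (blockX k t (block p))) = 0.
  have := congr1 d (sum_blockX k t); rewrite raddf0 raddf_sum (bigD1 (block p)) //=.
  by rewrite big1 ?addr0.
have le_p : (U_(p) *+ expo p <= blockM t (block p))%MM.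
  apply/mnm_lepP => r; rewrite mulmnE mnm1E blockME.
  by case: eqP => [->|_]; rewrite ?eqxx ?mul1n // mul0n.
(* T_p^l_p is split off; the remaining factor is free of T_p and is killed by d. *)
move: dp; rewrite /blockX -(submK le_p) mpolyXD -mpolyXn rmorphM rmorphXn /=.
have [s es] : exists s, expo p = s.+1.
  by case: (expo p) (expo_gt0 p) => // s; exists s.
rewrite d_leibniz es derX //= der_monomial_eq0 ?mul0r ?add0r => [|r].
  rewrite mulrnAr -rmorphXn mpolyXn => /talg_mulrn_eq0.
  have wp := d_deg (thomog_var p).
  case/(thomog_mul_eq0 (thomog_monomial _) (thomogM (thomog_monomial _) wp)).
    by apply/eqP/tprojX_neq0.
  case/(thomog_mul_eq0 (thomog_monomial _) wp); last exact/eqP.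
  by apply/eqP/tprojX_neq0.
rewrite -es mnmBE mulmnE mnm1E blockME => nr; apply: other.
by apply: contraNneq nr => ->; rewrite !eqxx mul1n subnn.
Qed.

Lemma thomog_der_Eset : (exists f, d f != 0) ->
  exists (a b : 'I_3) (ca : 'I_(tri_size t a)) (cb : 'I_(tri_size t b)),
    [/\ a != b, tri_exp cb = 1%N & Eset ca cb e].
Proof.
move=> [f nf]; have [a na] : exists a, d (tproj 'X_a) != 0.
  apply: contrapT => no_a; move/eqP: nf; apply; apply: der_eq0 => a.
  by apply/eqP/negP => /negP na; apply: no_a; exists a.
have [b nb nab] := der_var_two_blocks na.
have [ma ema ma0] := der_var_monomial na.
have [mb emb mb0] := der_var_monomial nb.
have [eb1|eb] := eqVneq (expo b) 1%N.
  exists (block a), (block b), (tagnat.sig2 a), (tagnat.sig2 b); split=> //.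
  exact: degM_Eset ema emb ma0 mb0 nab eb1.
have [ea1|ea] := eqVneq (expo a) 1%N.
  exists (block b), (block a), (tagnat.sig2 b), (tagnat.sig2 a).
  rewrite eq_sym; split=> //; apply: degM_Eset emb ema mb0 ma0 _ ea1.
  by rewrite eq_sym.
(* With l_b > 1, the equation m_b + 1 = (s + 1) l_b forces m_b > 0, so T_b divides d T_a; the
   symmetric argument follows. *)
have [|v [h [vh eh]]] := @der_var_divisible a b.
  move=> m em; have [s [sb _]] := degM_block_shift em emb mb0 nab.
  by move: (expo_gt0 b) eb sb; nia.
have [|v' [h' [vh' eh']]] := @der_var_divisible b a.
  rewrite eq_sym in nab.
  move=> m em; have [s [sb _]] := degM_block_shift em ema ma0 nab.
  by move: (expo_gt0 a) ea sb; nia.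
by case: (der_cross_eq0 (thomog_var a) (thomog_var b) vh vh' eh eh') => d0;
  [move: na|move: nb]; rewrite d0 eqxx.
Qed.

End HomogeneousLND.

(** * Jacobian derivations: every element of E(T_a, T_b) is a root *)

Section JacobianDerivation.
Variables (k : closedFieldType) (t : trinomial_data).

Local Notation n := (tdim t).
Local Notation block := (@tagnat.sig1 3 (tri_size t)).
Local Notation P := {mpoly k[n]}.
Local Notation A := (talg k t).
Local Notation tproj := (@tproj k t).
Local Notation g := (trinomial k t).

Section Jacobian.
Variables (h : P) (a b : 'I_n).

(** The Jacobian determinant of (p, g) with respect to (T_a, T_b), times h. *)
Definition jacobian (p : P) : P := h * (g^`M(b) * p^`M(a) - g^`M(a) * p^`M(b)).

Lemma jacobianD p q : jacobian (p + q) = jacobian p + jacobian q.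
Proof. rewrite /jacobian !mderivD; ring. Qed.

Lemma jacobianZ c p : jacobian (c *: p) = c *: jacobian p.
Proof. rewrite /jacobian !mderivZ -!mul_mpolyC; ring. Qed.

Lemma jacobianM p q : jacobian (p * q) = jacobian p * q + p * jacobian q.
Proof. rewrite /jacobian !mderivM; ring. Qed.

Lemma jacobian_trinomial : jacobian g = 0.
Proof. rewrite /jacobian; ring. Qed.

Definition jacobian_der (f : A) : A := tproj (jacobian (repr f)).

(** Independence of the chosen representative: a multiple q g is sent to a multiple of g, because g
    itself is killed. *)
Lemma jacobian_derE p : jacobian_der (tproj p) = tproj (jacobian p).
Proof.
have /tproj_eq0[q /(canRL (subrK _)) eq] : tproj (repr (tproj p) - p) = 0.
  by rewrite raddfB /= [X in X - _]reprK subrr.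
rewrite /jacobian_der eq jacobianD jacobianM jacobian_trinomial mulr0 addr0.
by rewrite raddfD /= rmorphM /= tproj_trinomial mulr0 add0r.
Qed.

Lemma jacobian_der_is_linear : linear jacobian_der.
Proof.
move=> c f f'; have [p ->] := tproj_surj f; have [p' ->] := tproj_surj f'.
rewrite -tprojZ -raddfD !jacobian_derE -tprojZ -raddfD /=.
by rewrite jacobianD jacobianZ.
Qed.

HB.instance Definition _ :=
  GRing.isLinear.Build k A A *:%R jacobian_der jacobian_der_is_linear.

Lemma jacobian_der_leibniz : leibniz jacobian_der.
Proof.
move=> f f'; have [p ->] := tproj_surj f; have [p' ->] := tproj_surj f'.
by rewrite -rmorphM !jacobian_derE jacobianM raddfD /= !rmorphM.
Qed.

Lemma mhomog_deriv w p (q : P) : mhomog w q -> mhomog (w - degX p) q^`M(p).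
Proof.
move=> hq m; rewrite mcoeff_msupp mcoeff_deriv => nm.
rewrite -(hq (m + U_(p))%MM) ?degMD ?degM_var ?addrK // mcoeff_msupp.
by apply: contraNneq nm => ->; rewrite mul0rn.
Qed.

Lemma jacobian_der_degree w : mhomog w h ->
  der_degree jacobian_der (degg t - degX a - degX b + w).
Proof.
move=> wh v _ [p vp ->]; exists (jacobian p); last exact: jacobian_derE.
have hg := @mhomog_trinomial k t.
rewrite [v + _]addrA addrC; apply: mhomogM => //.
apply: mhomogD; last rewrite -scaleN1r; last apply: mhomogZ.
  have -> : v + (degg t - degX a - degX b) = (degg t - degX b) + (v - degX a).
    by rewrite addrC -!addrA; congr (_ + _); rewrite addrCA [v + _]addrC.
  by apply: mhomogM; apply: mhomog_deriv.
have -> : v + (degg t - degX a - degX b) = (degg t - degX a) + (v - degX b).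
  by rewrite addrC -!addrA; congr (_ + (_ + _)); rewrite addrC.
by apply: mhomogM; apply: mhomog_deriv.
Qed.

End Jacobian.

Lemma mderiv_trinomial (p : 'I_n) :
  g^`M(p) = (expo p)%:R *: 'X_[blockM t (block p) - U_(p)].
Proof.
rewrite trinomialE raddf_sum (bigD1 (block p)) //= big1 => [|i ni].
  by rewrite addr0 mderivX blockME eqxx.
by rewrite mderivX blockME eq_sym (negPf ni) scale0r.
Qed.

(** * Local nilpotency when h is a monomial free of T_a and T_b *)

Section Elementary.
Variables (u : 'X_{1..n}) (a b : 'I_n).
Hypotheses (ua : u a = 0%N) (ub : u b = 0%N).
Hypotheses (ab : block a != block b) (eb : expo b = 1%N).

Local Notation d := (jacobian_der 'X_[u] a b).

Let ab_neq : a != b.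
Proof. by apply: contraNneq ab => ->. Qed.

Let subUU (p : 'I_n) : (U_(p) - U_(p) = 0 :> 'X_{1..n})%MM.
Proof. by apply/mnmP => r; rewrite mnmBE subnn mnm0E. Qed.

Lemma jacobian_der_var p : d (tproj 'X_p) =
  if p == a then tproj 'X_[u + (blockM t (block b) - U_(b))]
  else if p == b then
    - (expo a)%:R *: tproj 'X_[u + (blockM t (block a) - U_(a))] else 0.
Proof.
rewrite jacobian_derE /jacobian !mderivX !mnm1E !mderiv_trinomial eb scale1r.
have [->|pa] := eqVneq p a; first rewrite (negPf ab_neq).
  by rewrite scale0r mulr0 subr0 subUU mpolyX0 scale1r mulr1 mpolyXD.
rewrite scale0r mulr0 sub0r; have [->|pb] := eqVneq p b.
  rewrite subUU mpolyX0 scale1r mulr1 -scaleNr -scalerAr -mpolyXD.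
  exact: tprojZ.
by rewrite scale0r mulr0 oppr0 mulr0 raddf0.
Qed.

Lemma nilpotent_at_monomial (m : 'X_{1..n}) :
    (forall p, m p != 0%N -> nilpotent_at d (tproj 'X_p)) ->
  nilpotent_at d (tproj 'X_[m]).
Proof.
move=> hm; rewrite (mpolyXE_id _ m) rmorph_prod.
apply: (big_ind (nilpotent_at d)) => [|f f'|p _].
- exact/nilpotent_at1/jacobian_der_leibniz.
- exact/nilpotent_atM/jacobian_der_leibniz.
rewrite rmorphXn /=; have [->|mp] := eqVneq (m p) 0%N.
  exact/nilpotent_at1/jacobian_der_leibniz.
exact/nilpotent_atX/hm/mp/jacobian_der_leibniz.
Qed.

(** Triangularity: nilpotency is shown first for the variables that d kills, then for T_a, then for
    T_b, and it passes to products and sums. *)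
Lemma jacobian_der_lnd : locally_nilpotent d.
Proof.
have nil_other p : p != a -> p != b -> nilpotent_at d (tproj 'X_p).
  by move=> pa pb; exists 1%N; rewrite /= jacobian_der_var (negPf pa) (negPf pb).
(* As l_b = 1, the monomial F_b / T_b is free of T_b, so d T_a involves only killed variables. *)
have nil_a : nilpotent_at d (tproj 'X_a).
  apply: nilpotent_at_der; rewrite /= jacobian_der_var eqxx.
  apply: nilpotent_at_monomial => p; rewrite mnmDE mnmBE mnm1E blockME => hp.
  apply: nil_other; apply: contraNneq hp => ->.
    by rewrite ua (negPf ab).
  by rewrite ub !eqxx eb.
(* F_a / T_a may still contain T_a, which is already settled, but not T_b. *)
have nil_b : nilpotent_at d (tproj 'X_b).
  apply: nilpotent_at_der; rewrite /= jacobian_der_var eq_sym (negPf ab_neq) eqxx.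
  rewrite -mulr_algl; apply: nilpotent_atM; first exact: jacobian_der_leibniz.
    exists 1%N; rewrite /= linearZ /= der1 ?scaler0 //.
    exact: jacobian_der_leibniz.
  apply: nilpotent_at_monomial => p; rewrite mnmDE mnmBE mnm1E blockME => hp.
  have [->//|pa] := eqVneq p a; apply: nil_other => //.
  by apply: contraNneq hp => ->; rewrite ub (eq_sym (block b)) (negPf ab).
move=> f; have [p ->] := tproj_surj f; rewrite tproj_sum.
apply: (big_ind (nilpotent_at d)) => [|f1 f2|m _].
- exact: nilpotent_at0.
- exact: nilpotent_atD.
have [s hs] : nilpotent_at d (tproj 'X_[m]).
  apply: nilpotent_at_monomial => r _.
  by have [->//|ra] := eqVneq r a; have [->//|rb] := eqVneq r b; apply: nil_other.
exists s; suff -> f1 : iter s d (p@_m *: f1) = p@_m *: iter s d f1.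
  by rewrite hs scaler0.
by elim: s {hs} => // s IH; rewrite !iterS IH [LHS]linearZ.
Qed.

Lemma is_root_jacobian : is_root k (degg t - degX a - degX b + degM u).
Proof.
have deg_d := @jacobian_der_degree 'X_[u] a b _ (@mhomogX k t u).
exists (jacobian_der 'X_[u] a b); split=> //.
- exact: jacobian_der_leibniz.
- exact: jacobian_der_lnd.
- by exists (tproj 'X_a); rewrite [X in X != _]jacobian_der_var eqxx tprojX_neq0.
by move=> f [w wf]; exists (w + (degg t - degX a - degX b + degM u)); apply: deg_d.
Qed.

End Elementary.

Lemma Eset_is_root (a b : 'I_3) (ca : 'I_(tri_size t a)) (cb : 'I_(tri_size t b)) e :
  a != b -> tri_exp cb = 1%N -> Eset ca cb e -> is_root k e.
Proof.
move=> ab eb [u ->].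
(* The values of [u] at the two excluded coordinates do not enter the sum, so they are replaced by
   0. *)
pose v : 'X_{1..n} :=
  [multinom if (p == tidx ca) || (p == tidx cb) then 0%N else u p | p < n].
have -> : \sum_(p < n | (p != tidx ca) && (p != tidx cb)) degX p *+ u p = degM v.
  rewrite [LHS]big_mkcond; apply: eq_bigr => p _; rewrite mnmE -negb_or.
  by case: (_ || _).
apply: is_root_jacobian; rewrite ?block_tidx ?expo_tidx //.
  by rewrite mnmE eqxx.
by rewrite mnmE eqxx orbT.
Qed.

End JacobianDerivation.

Theorem proposition5 (k : closedFieldType) (k_char0 : [pchar k] =i pred0)
    (t : trinomial_data) (e : fgroup t) :
  is_root k e <->
  exists (a b : 'I_3) (ca : 'I_(tri_size t a)) (cb : 'I_(tri_size t b)),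
    [/\ a != b, tri_exp cb = 1%N & Eset ca cb e].
Proof.
split=> [[d [d_leibniz d_lnd d_neq0 _ d_deg]]|[a [b [ca [cb [ab eb ee]]]]]].
  exact (thomog_der_Eset k_char0 d_leibniz d_lnd d_deg d_neq0).
exact: Eset_is_root ab eb ee.
Qed.
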